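(* Let $(V,v)$ be a pair of continuous upper and lower probabilities on $(\Omega,\mathcal{F})$. Let $\mathbf{Y}=\{Y_n\}_{n\in\mathbb{N}}$ be a bounded stochastic process (i.e. $\sup_{n,\omega}|Y_n(\omega)|<\infty$) which is stationary on $(\Omega,\mathcal{F},V)$ and ergodic. Then there exists a constant $c$ such that $$v\Big(\Big\{\omega\in\Omega:\ \lim_{n\to\infty}\frac1n\sum_{k=1}^{n}Y_k(\omega)=c\Big\}\Big)=1.$$ If moreover $V$ is concave (equivalently $v$ is convex), then $c\in\left[\int_{\Omega}Y_1\, dv,\int_{\Omega}Y_1\, dV\right]$.
   Context: For a nonempty set $\mathcal{P}$ of finitely additive probabilities on $\mathcal{F}$, $V(A)=\sup_{P\in\mathcal{P}}P(A)$ and $v(A)=\inf_{P\in\mathcal{P}}P(A)$; continuity means $V(A_n)\to V(A)$ whenever $A_n\uparrow A$ or $A_n\downarrow A$ (and likewise for $v$). $V$ is concave if $V(A\cup B)+V(A\cap B)\le V(A)+V(B)$; $v$ is convex if the reverse inequality holds. $\mathbf{Y}$ is stationary on $(\Omega,\mathcal{F},V)$ if for all $n\in\mathbb{N}$, $k\in\mathbb{N}_0$ and Borel $A\subseteq\mathbb{R}^{k+1}$, $V(\{(Y_n,\dots,Y_{n+k})\in A\})=V(\{(Y_{n+1},\dots,Y_{n+1+k})\in A\})$. Let $\mathbb{R}^{\mathbb{N}}$ carry the $\sigma$-algebra $\sigma(\mathcal{C})$ generated by cylinders $\{\mathbf{x}:(x_1,\dots,x_n)\in H\}$, $H\in\mathcal{B}(\mathbb{R}^n)$;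 let $\tau(x_1,x_2,\dots)=(x_2,x_3,\dots)$ be the shift and $V_{\mathbf{Y}}(C)=V(\mathbf{Y}^{-1}(C))$ for $C\in\sigma(\mathcal{C})$, where $\mathbf{Y}(\omega)=(Y_1(\omega),Y_2(\omega),\dots)$. $\mathbf{Y}$ is ergodic if $\tau$ is ergodic with respect to $V_{\mathbf{Y}}$, meaning $\tau$ preserves $V_{\mathbf{Y}}$ and for every $B\in\sigma(\mathcal{C})$ with $\tau^{-1}B=B$: $V_{\mathbf{Y}}(B)\in\{0,1\}$ and ($V_{\mathbf{Y}}(B)=0$ or $V_{\mathbf{Y}}(B^c)=0$). Choquet integral: $\int_{\Omega}\xi\, d\mu=\int_{0}^{\infty}\mu(\{\xi\ge t\})\,dt+\int_{-\infty}^0[\mu(\{\xi\ge t\})-1]\,dt$. *)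

(* Defs.v *)
From HB Require Import structures.
From mathcomp Require Import all_boot all_order all_algebra.
From mathcomp Require Import all_classical all_reals all_analysis.
Set Implicit Arguments. Unset Strict Implicit. Unset Printing Implicit Defensive.
Import Order.TTheory GRing.Theory Num.Theory.
Import numFieldNormedType.Exports.
Local Open Scope classical_set_scope.
Local Open Scope ring_scope.

Section Defs.
Context {d : measure_display} {T : measurableType d} {R : realType}.

Definition fa_prob (P : set T -> R) : Prop :=
  P setT = 1 /\
  (forall A, measurable A -> 0 <= P A) /\
  (forall A B, measurable A -> measurable B -> A `&` B = set0 ->
     P (A `|` B) = P A + P B).

Definition upper (Ps : set (set T -> R)) (A : set T) : R :=
  sup [set P A | P in Ps].
Definition lower (Ps : set (set T -> R)) (A : set T) : R :=
  inf [set P A | P in Ps].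

Definition cap_continuous (mu : set T -> R) : Prop :=
  (forall A : nat -> set T, (forall n, measurable (A n)) ->
     (forall n, A n `<=` A n.+1) ->
     mu (A n) @[n --> \oo] --> mu (\bigcup_n A n)) /\
  (forall A : nat -> set T, (forall n, measurable (A n)) ->
     (forall n, A n.+1 `<=` A n) ->
     mu (A n) @[n --> \oo] --> mu (\bigcap_n A n)).

Definition concave_cap (mu : set T -> R) : Prop :=
  forall A B, measurable A -> measurable B ->
    mu (A `|` B) + mu (A `&` B) <= mu A + mu B.

Definition borel_rV (m : nat) : set (set 'rV[R]_m) :=
  <<s [set U : set 'rV[R]_m | open U] >>.

(* Process indexed by nat: Y 0, Y 1, ... stand for Y_1, Y_2, ... *)
Definition stationary (mu : set T -> R) (Y : nat -> T -> R) : Prop :=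
  forall (n k : nat) (A : set 'rV[R]_k.+1), borel_rV A ->
    mu [set x | A (\row_(i < k.+1) Y (n + i)%N x)] =
    mu [set x | A (\row_(i < k.+1) Y (n.+1 + i)%N x)].

Definition cylinders : set (set (nat -> R)) :=
  [set C | exists (m : nat) (H : set 'rV[R]_m.+1), borel_rV H /\
     C = [set x | H (\row_(i < m.+1) x (i : nat))]].

Definition sigmaC : set (set (nat -> R)) := <<s cylinders >>.

Definition shift (x : nat -> R) : nat -> R := fun n => x n.+1.

Definition Yseq (Y : nat -> T -> R) (w : T) : nat -> R := fun n => Y n w.

Definition law_cap (mu : set T -> R) (Y : nat -> T -> R)
  (C : set (nat -> R)) : R := mu (Yseq Y @^-1` C).

Definition ergodic (mu : set T -> R) (Y : nat -> T -> R) : Prop :=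
  (forall B, sigmaC B -> law_cap mu Y (shift @^-1` B) = law_cap mu Y B) /\
  (forall B, sigmaC B -> shift @^-1` B = B ->
     (law_cap mu Y B = 0 \/ law_cap mu Y B = 1) /\
     (law_cap mu Y B = 0 \/ law_cap mu Y (~` B) = 0)).

Definition choquet (mu : set T -> R) (xi : T -> R) : \bar R :=
  (\int[lebesgue_measure]_(t in `[0%R, +oo[) (mu [set w | t <= xi w])%:E
   + \int[lebesgue_measure]_(t in `]-oo, 0%R[) (mu [set w | t <= xi w] - 1)%:E)%E.

Definition avg (Y : nat -> T -> R) (w : T) (n : nat) : R :=
  n.+1%:R^-1 * \sum_(k < n.+1) Y k w.

End Defs.

(* Main.v *)
(* For every path and every level t below the limsup of s times the averages
   (s = 1 or -1), the average of s Y first exceeds t at a finite time; by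
   continuity from above of V, that time is at most N off an event A with V(A)
   small. Cutting {0, ..., L-1} into stopping blocks bounds the sum of the s Y_k,
   k < L, from below by t L up to a constant and a multiple of the number of
   k < L at which the shifted path lies in A. Integrating this pathwise bound
   against one finitely additive P <= V, with P(A shifted by k) <= V(A) by
   invariance, replaces the ergodic theorem. By ergodicity limsup and -liminf
   exceed each level V-almost surely or V-almost never; if they did so with
   levels t and u, t + u > 0, adding the two bounds would give a contradiction,
   so the averages converge to a constant c off a V-null set. The same bounds
   with s Y_k replaced by staircase approximations give v-Riemann sums <= c <=
   V-Riemann sums, because v <= P <= V. *)
Require Import Defs.
From HB Require Import structures.
From mathcomp Require Import all_boot all_order all_algebra.
From mathcomp Require Import all_classical all_reals all_analysis.
From mathcomp Require Import measurable_realfun measurable_fun_approximation.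
From mathcomp Require Import zify lra.
Set Implicit Arguments. Unset Strict Implicit. Unset Printing Implicit Defensive.
Import Order.TTheory GRing.Theory Num.Theory.
Import numFieldNormedType.Exports.
Local Open Scope classical_set_scope.
Local Open Scope ring_scope.

(** * Pathwise inequalities for finite sums *)

(** Greedy cutting into blocks. At a marked position ([a] true) a block of length one is removed; it
    loses at most [K], which its marker pays. At an unmarked position the block of length at most
    [N.+1] with nonnegative sum is removed. Once at most [N.+1] positions remain, such a block could
    overrun [L], and the last term pays for all of them. In the application [z k] is
    [s * Y k w - t]. *)
Lemma stopping_sum_ge (R : realFieldType) (K : R) (N L : nat) (z : nat -> R)
    (a : nat -> bool) :
  (forall i, `|z i| <= K) ->
  (forall k, ~~ a k -> exists2 n, (n <= N)%N & 0 <= \sum_(i < n.+1) z (k + i)%N) ->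
  0 <= \sum_(i < L) z i + K * (\sum_(i < L) (a i)%:R) + K * N.+1%:R.
Proof.
have [m] := ubnP L; elim: m => // m IH in L z a * => /ltnSE Lm zK az.
have K0 : 0 <= K by apply: le_trans (zK 0%N).
have zNK i : - K <= z i by have := zK i; rewrite ler_norml => /andP[].
have [LN|NL] := leqP L N.+1.
  have : - K * L%:R <= \sum_(i < L) z i.
    rewrite mulrC mulr_natl -[X in _ *+ X](card_ord L) -sumr_const.
    by apply: ler_sum => i _.
  have : 0 <= K * (\sum_(i < L) (a i)%:R :> R).
    by rewrite mulr_ge0// sumr_ge0.
  have : K * L%:R <= K * N.+1%:R by rewrite ler_wpM2l// ler_nat.
  lra.
have step n : (n.+1 <= L)%N -> (n < m)%N ->
    0 <= \sum_(i < n.+1) z i + K * (\sum_(i < n.+1) (a i)%:R) ->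
    0 <= \sum_(i < L) z i + K * (\sum_(i < L) (a i)%:R) + K * N.+1%:R.
  move=> nL nm h.
  have Lm' : (L - n.+1 < m)%N by lia.
  have := IH (L - n.+1)%N (fun i => z (n.+1 + i)%N) (fun i => a (n.+1 + i)%N) Lm'
    (fun i => zK _).
  move=> /(_ _)/wrap[].
    move=> k /az[p pN hp]; exists p => //.
    by under eq_bigr do rewrite addnA.
  have spl (f : nat -> R) : \sum_(i < L) f i =
      \sum_(i < n.+1) f i + \sum_(i < L - n.+1) f (n.+1 + i)%N.
    have -> : L = (n.+1 + (L - n.+1))%N by lia.
    rewrite big_split_ord/=; congr (_ + _).
    by rewrite addKn.
  rewrite (spl z) (spl (fun i => (a i)%:R)) mulrDr.
  lra.
have [a0|/az[n nN hn]] := boolP (a 0%N).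
  apply: (step 0%N); [lia|lia|].
  rewrite !big_ord_recl !big_ord0 a0 /= mulr1n.
  have := zNK 0%N; lra.
apply: (step n); [lia|lia|].
rewrite addr_ge0// mulr_ge0// sumr_ge0//.
Qed.

(** The sum counts the integers among 1, ..., [n] that are at most [z]: it is the integer part of
    [z] capped at [n]. *)
Lemma staircase_le (R : realFieldType) (n : nat) (z : R) : 0 <= z ->
  \sum_(j < n) (j.+1%:R <= z)%R%:R <= z /\
  (z <= n%:R -> z <= \sum_(j < n) (j.+1%:R <= z)%R%:R + 1).
Proof.
move=> z0; elim: n => [|n [IH1 IH2]].
  by rewrite big_ord0; split => //; lra.
rewrite big_ord_recr/=.
have all1 : n%:R <= z -> \sum_(j < n) (j.+1%:R <= z)%R%:R = n%:R :> R.
  move=> nz; rewrite (eq_bigr (fun=> 1)) ?sumr_const ?card_ord// => i _.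
  by rewrite (le_trans _ nz)// ler_nat.
have [nz|zn] := leP n.+1%:R z.
  have := nz; rewrite -natr1 => nz'.
  rewrite all1 /= ?mulr1n; last by lra.
  by split; lra.
rewrite addr0; split => // _.
have [/IH2//|nz] := leP z n%:R.
rewrite all1; last exact: ltW.
by rewrite natr1 ltW.
Qed.

(** * Finitely additive probabilities and expectations of simple functions *)

Section finitely_additive.
Context {d : measure_display} {T : measurableType d} {R : realType}.
Implicit Types (P : set T -> R) (A B : set T).

(* [e] is a P-expectation of the simple function [f]; uniqueness of [e] is not
   needed, only its monotonicity [simple_exp_ge]. *)
Definition simple_exp P (f : T -> R) (e : R) := exists s : seq (R * set T),
  [/\ forall p, p \in s -> measurable p.2,
      forall w, f w = \sum_(p <- s) p.1 * \1_(p.2) w &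
      e = \sum_(p <- s) p.1 * P p.2].

Lemma fa_prob0 P : fa_prob P -> P set0 = 0.
Proof.
move=> [_ [_ /(_ set0 set0 measurable0 measurable0)]].
by rewrite setU0 setI0 => /(_ erefl); lra.
Qed.

Lemma fa_probC P A : fa_prob P -> measurable A -> P (~` A) = 1 - P A.
Proof.
move=> [P1 [_ PU]] mA.
have := PU A (~` A) mA (measurableC mA) (setICr A); rewrite setUv P1; lra.
Qed.

Lemma fa_prob_le P A B : fa_prob P -> measurable A -> measurable B ->
  A `<=` B -> P A <= P B.
Proof.
move=> [_ [P0 PU]] mA mB AB.
have := PU A (B `\` A) mA (measurableD mB mA) (setDIK _ _).
rewrite setDUK// => ->.
by rewrite lerDl P0//; exact: measurableD.
Qed.

Lemma fa_prob_itv P A : fa_prob P -> measurable A -> 0 <= P A <= 1.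
Proof.
move=> faP mA; have [P1 [P0 _]] := faP; rewrite P0//= -P1.
exact: (@fa_prob_le P A setT faP mA measurableT).
Qed.

(** Positivity of the finitely additive integral, by splitting [E] along the first set [B] of the
    list: inside [B] the threshold drops by [a], outside it stays. Hence [E] and [kappa] must vary
    in the induction. *)
Lemma fa_sum_ge P (s : seq (R * set T)) (E : set T) (kappa : R) :
  fa_prob P -> measurable E -> (forall p, p \in s -> measurable p.2) ->
  (forall w, E w -> kappa <= \sum_(p <- s) p.1 * \1_(p.2) w) ->
  kappa * P E <= \sum_(p <- s) p.1 * P (p.2 `&` E).
Proof.
move=> faP; have [_ [P0 PU]] := faP.
elim: s => [|[a B] s IH] in E kappa * => mE ms h.
  rewrite big_nil; have [->|/set0P[w Ew]] := eqVneq E set0; first by rewrite fa_prob0// mulr0.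
  by have := h w Ew; rewrite big_nil => k0; rewrite mulr_le0_ge0// P0.
have mB : measurable B by apply: (ms (a, B)); rewrite mem_head.
have ms' p : p \in s -> measurable p.2 by move=> ps; apply: ms; rewrite inE ps orbT.
have mEB := measurableI _ _ mE mB; have mDB := measurableD mE mB.
have spl C : measurable C -> P (C `&` E) = P (C `&` (E `&` B)) + P (C `&` (E `\` B)).
  move=> mC; rewrite -PU; [|exact: measurableI..|].
    by rewrite -setIUr setUIDK.
  by apply/seteqP; split=> w //= [[_ [_ Bw]] [_ [_ nBw]]].
have h1 : (kappa - a) * P (E `&` B) <= \sum_(p <- s) p.1 * P (p.2 `&` (E `&` B)).
  apply: IH => // w [Ew Bw]; have := h w Ew.
  by rewrite big_cons /= indicE mem_set// mulr1; lra.
have h2 : kappa * P (E `\` B) <= \sum_(p <- s) p.1 * P (p.2 `&` (E `\` B)).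
  apply: IH => // w [Ew Bw]; have := h w Ew.
  by rewrite big_cons /= indicE memNset// mulr0 add0r.
rewrite big_cons /=.
have -> : \sum_(p <- s) p.1 * P (p.2 `&` E) =
    \sum_(p <- s) p.1 * P (p.2 `&` (E `&` B)) + \sum_(p <- s) p.1 * P (p.2 `&` (E `\` B)).
  rewrite -big_split/=; apply: eq_big_seq => p ps.
  by rewrite spl ?mulrDr//; exact: ms'.
have := spl setT measurableT; rewrite !setTI => ->.
rewrite (setIC B E); lra.
Qed.

Lemma simple_exp_ge P f e kappa : fa_prob P -> simple_exp P f e ->
  (forall w, kappa <= f w) -> kappa <= e.
Proof.
move=> faP [s [ms fE ->]] kf.
have := @fa_sum_ge P s setT kappa faP measurableT ms.
rewrite faP.1 mulr1; under eq_bigr do rewrite setIT; apply => w _.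
by rewrite -fE.
Qed.

Lemma simple_expD P f g e e' : simple_exp P f e -> simple_exp P g e' ->
  simple_exp P (fun w => f w + g w) (e + e').
Proof.
move=> [s [ms fE ->]] [s' [ms' gE ->]]; exists (s ++ s'); split.
- by move=> p; rewrite mem_cat => /orP[/ms|/ms'].
- by move=> w; rewrite big_cat fE gE.
- by rewrite big_cat.
Qed.

Lemma simple_expZ P f e k : simple_exp P f e ->
  simple_exp P (fun w => k * f w) (k * e).
Proof.
move=> [s [ms fE ->]]; exists [seq (k * p.1, p.2) | p <- s]; split.
- by move=> p /mapP[q /ms mq ->].
- by move=> w; rewrite big_map fE mulr_sumr; apply: eq_bigr => p _; rewrite mulrA.
- by rewrite big_map mulr_sumr; apply: eq_bigr => p _; rewrite mulrA.
Qed.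

Lemma simple_exp_indic P A : measurable A -> simple_exp P \1_A (P A).
Proof.
move=> mA; exists [:: (1, A)]; split.
- by move=> p; rewrite inE => /eqP ->.
- by move=> w; rewrite big_seq1 mul1r.
- by rewrite big_seq1 mul1r.
Qed.

Lemma simple_exp_cst P k : fa_prob P -> simple_exp P (fun=> k) k.
Proof.
move=> [P1 _]; exists [:: (k, setT)]; split.
- by move=> p; rewrite inE => /eqP ->; exact: measurableT.
- by move=> w; rewrite big_seq1 indicE mem_set// mulr1.
- by rewrite big_seq1 /= P1 mulr1.
Qed.

Lemma simple_exp_sum P n (f : nat -> T -> R) (e : nat -> R) :
  (forall i, simple_exp P (f i) (e i)) ->
  simple_exp P (fun w => \sum_(i < n) f i w) (\sum_(i < n) e i).
Proof.
move=> h; elim: n => [|n IH].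
  exists [::]; split => // [w|]; by rewrite ?big_nil big_ord0.
rewrite big_ord_recr/=.
under eq_fun do rewrite big_ord_recr/=.
exact: simple_expD.
Qed.

End finitely_additive.

(** * Exceedance events, shift invariance and convergence of averages in sequence space *)

Section sequence_space.
Context {R : realType}.
Implicit Types (x : nat -> R) (s t r : R).

Definition exceed s t m : set (nat -> R) :=
  [set x | t * m.+1%:R < s * \sum_(i < m.+1) x i].

(** The event that the limsup of [s] times the averages is strictly above [t]. The slack
    [k.+1%:R^-1] expresses strictness by countable operations. *)
Definition limsup_gt s t : set (nat -> R) :=
  \bigcup_k \bigcap_n \bigcup_(m in [set m | (n <= m)%N])
    exceed s (t + k.+1%:R^-1) m.

Definition mean_cvg (c : R) : set (nat -> R) :=
  [set x : nat -> R | n.+1%:R^-1 * \sum_(i < n.+1) x i @[n --> \oo] --> c].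

Lemma exceed_subset s t r m : r <= t -> exceed s t m `<=` exceed s r m.
Proof. by move=> rt x; apply: le_lt_trans; rewrite ler_wpM2r. Qed.

Lemma limsup_gt_subset s t r : r <= t -> limsup_gt s t `<=` limsup_gt s r.
Proof.
move=> rt x [k _ h]; exists k => // n _; have [m nm hm] := h n I.
by exists m => //; apply: exceed_subset hm; rewrite lerD2r.
Qed.

Lemma linear_dominates r r' (C : R) : r' < r ->
  exists n0, forall m, (n0 <= m)%N -> r' * m%:R + C <= r * m%:R.
Proof.
move=> rr; exists (Num.trunc (C / (r - r'))).+1 => m mn.
have rr0 : 0 < r - r' by rewrite subr_gt0.
have : C / (r - r') <= m%:R.
  by apply: le_trans (ltW (truncnS_gt _)) _; rewrite ler_nat.
rewrite ler_pdivrMr//; lra.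
Qed.

(** Dropping the first coordinate changes the sum by [s * x 0] and the length by one, a bounded
    effect. Lowering the slack from 1/(k+1) to 1/(k+2) gains an amount linear in [m], which
    dominates it for large [m]. *)
Lemma shift_limsup_gt s t : Defs.shift @^-1` (limsup_gt s t) = limsup_gt s t.
Proof.
have inv_lt k : t + k.+2%:R^-1 < t + k.+1%:R^-1 :> R.
  by rewrite ltrD2l ltf_pV2 ?posrE// ltr_nat.
have sumS x m : \sum_(i < m.+2) x i = x 0%N + \sum_(i < m.+1) Defs.shift x i.
  by rewrite big_ord_recl.
apply/seteqP; split => x [k _ h]; exists k.+1 => // n _.
  have [n0 hn0] := @linear_dominates (t + k.+1%:R^-1) (t + k.+2%:R^-1)
    (t + k.+2%:R^-1 - s * x 0%N) (inv_lt k).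
  have [m /= nm hm] := h (maxn n n0) I.
  exists m.+1; first by rewrite /=; lia.
  move: hm (hn0 m.+1 ltac:(lia)); rewrite /exceed /mkset sumS -(natr1 m.+1).
  rewrite !mulrDr !mulr1.
  move: (t + k.+1%:R^-1) (t + k.+2%:R^-1) (m.+1%:R : R) (s * x 0%N) => r r' u c.
  by move: (r * u) (r' * u) => p q; lra.
have [n0 hn0] := @linear_dominates (t + k.+1%:R^-1) (t + k.+2%:R^-1)
  (s * x 0%N - (t + k.+2%:R^-1)) (inv_lt k).
have [[|m] // nm hm] := h (maxn n n0).+1 I.
exists m; first by move: nm; rewrite /=; lia.
have nm' : (n0 <= m.+2)%N by move: nm; rewrite /=; lia.
move: hm (hn0 m.+2 nm'); rewrite /exceed /mkset sumS -(natr1 m.+1).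
rewrite !mulrDr !mulr1.
  move: (t + k.+1%:R^-1) (t + k.+2%:R^-1) (m.+1%:R : R) (s * x 0%N) => r r' u c.
  by move: (r * u) (r' * u) => p q; lra.
Qed.

(** Turns failure of convergence to [c] into a countable union of shift-invariant events, each of
    which falls under the ergodic dichotomy. *)
Lemma not_mean_cvgE (c : R) : ~` mean_cvg c = \bigcup_j
  (limsup_gt 1 (c + j.+1%:R^-1) `|` limsup_gt (-1) (- c + j.+1%:R^-1)).
Proof.
apply/seteqP; split => x; last first.
  move=> [j _ h] xc.
  have j0 : (0 : R) < j.+1%:R^-1 by rewrite invr_gt0.
  have /cvgrPdist_lt /(_ _ j0)[n0 _ hn0] := xc.
  have k0 k : (0 : R) < k.+1%:R^-1 by rewrite invr_gt0.
  case: h => [] [k _ /(_ n0 I)[m /= n0m]]; move: (hn0 m n0m) (k0 k);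
    rewrite /exceed /mkset -ltr_pdivlMr// ltr_norml -mulrA [_ / _]mulrC;
    move: (_^-1) (_^-1 * _) (k.+1%:R^-1) => p q r; lra.
apply: contra_notP => nh.
apply/cvgrPdist_lt => e e0.
(* Half of [e], because 1/(j+1) is spent twice: once in the level of the event and once as its
   slack, taken with the same index [j]. *)
have [j _ je] := @near_infty_natSinv_lt R (PosNum (divr_gt0 e0 (ltr0Sn R 1))).
have {}je := je j (leqnn _); rewrite /= in je.
have hs s : (s = 1 \/ s = -1) -> exists n, forall m, (n <= m)%N ->
    s * (m.+1%:R^-1 * \sum_(i < m.+1) x i) <= s * c + j.+1%:R^-1 + j.+1%:R^-1.
  move=> ss; apply: contrapT => nn; apply: nh; exists j => //.
  have : limsup_gt s (s * c + j.+1%:R^-1) x.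
    exists j => // n _; apply: contrapT => nm; apply: nn; exists n => m /= mn.
    rewrite mulrCA mulrC ler_pdivrMr// leNgt; apply/negP => h; apply: nm.
    by exists m.
  by case: ss => ->; rewrite ?mul1r ?mulN1r; [left|right].
have [n1 h1] := hs 1 (or_introl erefl).
have [n2 h2] := hs (-1) (or_intror erefl).
exists (maxn n1 n2) => // m /= nm.
have := h1 m ltac:(lia); have := h2 m ltac:(lia).
rewrite ltr_norml !mul1r !mulN1r; move: (_^-1 * _) (j.+1%:R^-1) je => p q; lra.
Qed.

Lemma mean_cvg_le (c : R) s t x : mean_cvg c x -> (forall m, ~ exceed s t m x) ->
  s * c <= t.
Proof.
move=> xc h; apply: (cvgr_to_le (cvgM (cvg_cst s) xc)).
apply: nearW => n; rewrite [leLHS]mulrCA [leLHS]mulrC ler_pdivrMr// leNgt.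
exact/negP/h.
Qed.

End sequence_space.

(** * Measurability of path events *)

Section observable.
Context {d : measure_display} {T : measurableType d} {R : realType}.
Variable Y : nat -> T -> R.
Hypothesis mY : forall n, measurable_fun setT (Y n).

Definition tail_event k (B : set (nat -> R)) : set T :=
  [set w | B (fun n => Y (k + n)%N w)].

(* Both measurability requirements are needed: borel_rV is generated by all
   open sets, so that sigmaC B alone does not obviously make the Y-preimage of
   B measurable. *)
Definition observable (B : set (nat -> R)) := forall k,
  sigmaC [set x : nat -> R | B (fun n => x (k + n)%N)] /\
  measurable (tail_event k B).

Lemma observableC B : observable B -> observable (~` B).
Proof.
move=> oB k; have [cB mB] := oB k; split.
- exact: (@sigma_algebraC _ cylinders _ cB).
- exact: measurableC mB.
Qed.

Lemma observable_bigcup D (F : nat -> set (nat -> R)) :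
  (forall i, D i -> observable (F i)) -> observable (\bigcup_(i in D) F i).
Proof.
move=> oF k; split.
- by apply: (@bigcup_measurable _ (g_sigma_algebraType (@cylinders R))
    (fun i => [set x : nat -> R | F i (fun n => x (k + n)%N)]) D) => i /oF /(_ k)[].
- by apply: (bigcup_measurable (F := fun i => tail_event k (F i))) => i /oF /(_ k)[].
Qed.

Lemma observable_bigcapT (F : nat -> set (nat -> R)) :
  (forall i, observable (F i)) -> observable (\bigcap_i F i).
Proof.
move=> oF; rewrite -[X in observable X]setCK setC_bigcap.
by apply: observableC; apply: observable_bigcup => i _; exact: observableC.
Qed.

Lemma observableU A B : observable A -> observable B -> observable (A `|` B).
Proof.
move=> oA oB; rewrite -bigcup2E; apply: observable_bigcup => i _.
have o0 : observable set0.
  by rewrite -(@bigcup_set0 _ nat (fun=> A)); apply: observable_bigcup.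
by case: i => [|[|i]].
Qed.

Lemma borel_rV_open m (U : set 'rV[R]_m) : open U -> borel_rV U.
Proof. by move=> oU; exact: sub_sigma_algebra. Qed.

(** The base case for all later events. In sequence space, a half-space of a continuous linear form
    is open and gives a cylinder on the coordinates up to [k + m]; on the process side, a finite sum
    of measurable functions is measurable. *)
Lemma observable_exceed s t m : observable (exceed s t m).
Proof.
move=> k; split.
  apply: sub_sigma_algebra; exists (k + m)%N.
  pose f (u : 'rV[R]_(k + m).+1) := s * \sum_(i < m.+1) u ord0 (inord (k + i)).
  have cf : continuous f.
    have cs : continuous (fun u : 'rV[R]_(k + m).+1 =>
        \sum_(i < m.+1) u ord0 (inord (k + i))).
      apply: continuous_big => [[x y]|i _]; last exact: coord_continuous.
      by apply: cvgD; [exact: cvg_fst|exact: cvg_snd].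
    by move=> u; exact: (@cvgMl_tmp _ _ (nbhs u) _ _ s _ (cs u)).
  exists (f @^-1` [set y | t * m.+1%:R < y]); split.
    apply: borel_rV_open; apply: (@open_comp _ R); last exact: open_gt.
    by move=> u _; exact: cf.
  apply/funext => x; rewrite /exceed /preimage /mkset /f.
  congr (is_true (_ < s * _)); apply: eq_bigr => i _.
  by rewrite mxE inordK// ltnS leq_add2l -ltnS.
rewrite /tail_event /exceed/= -[X in measurable X]setTI.
have mf : measurable_fun setT (fun w => s * \sum_(i < m.+1) Y (k + i)%N w).
  apply: measurable_funM => //.
  by apply: measurable_sum => i; exact: mY.
have := mf measurableT `]t * m.+1%:R, +oo[%classic (measurable_itv _).
congr (measurable (_ `&` _)).
by apply/seteqP; split => w /=; rewrite in_itv/= andbT.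
Qed.

Lemma observable_limsup_gt s t : observable (limsup_gt s t).
Proof.
apply: observable_bigcup => k _; apply: observable_bigcapT => n.
by apply: observable_bigcup => m _; exact: observable_exceed.
Qed.

Lemma observable_not_mean_cvg c : observable (~` mean_cvg c).
Proof.
rewrite not_mean_cvgE; apply: observable_bigcup => j _.
by apply: observableU; exact: observable_limsup_gt.
Qed.

Lemma observable_bounded_time s t N :
  observable [set x | forall m, (m <= N)%N -> ~ exceed s t m x].
Proof.
have -> : [set x | forall m, (m <= N)%N -> ~ exceed s t m x] =
    ~` \bigcup_(m in [set m | (m <= N)%N]) exceed s t m.
  by rewrite setC_bigcup; apply/seteqP; split=> x h m; exact: h.
by apply: observableC; apply: observable_bigcup => m _; exact: observable_exceed.
Qed.

Lemma observable_never_exceed s t :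
  observable [set x | forall m, ~ exceed s t m x].
Proof.
have -> : [set x | forall m, ~ exceed s t m x] = ~` \bigcup_m exceed s t m.
  by rewrite setC_bigcup; apply/seteqP; split=> x h m; [move=> _|]; exact: h.
by apply: observableC; apply: observable_bigcup => m _; exact: observable_exceed.
Qed.

End observable.

Definition level (R : realType) (b : R) : set (nat -> R) := [set x | b <= x 0%N].

Lemma observable_level (d : measure_display) (T : measurableType d) (R : realType)
    (Y : nat -> T -> R) (b : R) :
  (forall n, measurable_fun setT (Y n)) -> observable Y (level b).
Proof.
move=> mY.
have -> : level b = ~` exceed (-1) (- b) 0.
  apply/funext => x; rewrite /level /exceed /setC /mkset big_ord1 mulr1 mulN1r ltrN2.
  by rewrite leNgt; apply/propext; split => /negP.
by apply: observableC; exact: observable_exceed.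
Qed.

(** * Riemann sums of tail functions and the Choquet integral *)

(** Layer-cake sum with right endpoints on the grid of mesh [h] starting at [- M]. For [G b] the
    indicator of [b <= y] it rounds [y] down to the grid; for [G b] the capacity of [b <= Y] it
    approximates the Choquet integral. *)
Definition riemann_sum (R : realType) (M h : R) (J : nat) (G : R -> R) : R :=
  - M + h * \sum_(j < J) G (- M + j.+1%:R * h).

Lemma staircase_approx (R : realType) (M h y : R) (J : nat) : 0 < h ->
  `|y| <= M -> 2 * M <= J%:R * h ->
  riemann_sum M h J (fun b => (b <= y)%R%:R) <= y <=
  riemann_sum M h J (fun b => (b <= y)%R%:R) + h.
Proof.
move=> h0 yM Jh; rewrite /riemann_sum.
have /andP[yM1 yM2] : - M <= y <= M by rewrite -ler_norml.
have z0 : 0 <= (y + M) / h by rewrite divr_ge0 ?(ltW h0)//; lra.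
have [h1 h2] := staircase_le J z0.
have zJ : (y + M) / h <= J%:R by rewrite ler_pdivrMr//; lra.
have -> : \sum_(j < J) (- M + j.+1%:R * h <= y)%R%:R =
    \sum_(j < J) (j.+1%:R <= (y + M) / h)%R%:R :> R.
  by apply: eq_bigr => j _; rewrite ler_pdivlMr// addrC lerBlDr.
move: h1 (h2 zJ).
rewrite ler_pdivlMr// ler_pdivrMr//; move: (\sum_(_ < _) _) => s.
lra.
Qed.

Section choquet_riemann.
Context {R : realType}.
Local Notation leb := (@lebesgue_measure R).

Lemma integral_piecewise_bounds (F : R -> R) (a h : R) (lo hi : nat -> R) (n : nat) :
  0 < h -> measurable_fun setT F -> (forall t, 0 <= F t) ->
  (forall j, 0 <= lo j) ->
  (forall j t, (j < n)%N -> a + j%:R * h <= t < a + j.+1%:R * h ->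
     lo j <= F t <= hi j) ->
  ((h * \sum_(j < n) lo j)%:E <= \int[leb]_(t in `[a, (a + n%:R * h)%R[) (F t)%:E
    <= (h * \sum_(j < n) hi j)%:E)%E.
Proof.
move=> h0 mF F0 lo0.
have mFE (D : set R) : measurable_fun D (fun t => (F t)%:E).
  by apply/measurable_EFinP; apply: measurable_funS mF.
elim: n => [|n IH] lohi.
  by rewrite !big_ord0 mul0r addr0 set_itvco0 integral_set0 mulr0 lexx.
have /andP[IH1 IH2] := IH (fun j t jn => lohi j t (leqW jn)).
set x := a + n%:R * h in IH1 IH2 *.
have xE : a + n.+1%:R * h = x + h by rewrite /x -natr1; lra.
have ax : a <= x by rewrite lerDl mulr_ge0// ltW.
have -> : `[a, a + n.+1%:R * h[%classic = `[a, x[ `|` `[x, x + h[ :> set R.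
  rewrite xE; apply/seteqP; split => t /=; rewrite !in_itv/=.
    by move=> /andP[at_ ->]; have [tx|xt] := ltP t x; [left; rewrite at_|right].
  by case=> /andP[h1 h2]; apply/andP; split; lra.
rewrite ge0_integral_setU//; [|exact: mFE|by move=> t _; rewrite lee_fin|]; last first.
  rewrite disj_set2E; apply/eqP/seteqP; split => t //=; rewrite !in_itv/=; lra.
have mu_piece : leb `[x, x + h[%classic = h%:E.
  by rewrite lebesgue_measure_itv/= lte_fin ltrDl h0 -EFinD addrAC subrr add0r.
have lohin t : x <= t < x + h -> lo n <= F t <= hi n.
  by move=> tx; apply: lohi => //; rewrite xE.
rewrite !big_ord_recr/= !mulrDr !EFinD; apply/andP; split; apply: leeD => //.
  rewrite mulrC EFinM -mu_piece -integral_cst//.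
  apply: ge0_le_integral => //= [t _||t]; [by rewrite lee_fin|exact: mFE|].
  by rewrite in_itv/= lee_fin => /lohin /andP[].
rewrite mulrC EFinM -mu_piece -integral_cst//.
apply: ge0_le_integral => //= [t _||t]; [by rewrite lee_fin|exact: mFE|].
by rewrite in_itv/= lee_fin => /lohin /andP[].
Qed.

(** [G] plays the tail function of a function bounded by [n%:R * h]. Monotonicity squeezes the
    integrals between right and left endpoint sums, which differ by at most [h] in total. *)
Lemma choquet_integral_riemann (G : R -> R) (h : R) (n : nat) : 0 < h ->
  nonincreasing_fun G -> (forall t, 0 <= G t <= 1) ->
  (forall t, t < - (n%:R * h) -> G t = 1) -> (forall t, n%:R * h <= t -> G t = 0) ->
  ((riemann_sum (n%:R * h) h (n + n) G)%:E <=
    \int[leb]_(t in `[0%R, +oo[) (G t)%:E +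
    \int[leb]_(t in `]-oo, 0%R[) (G t - 1)%:E <=
   (riemann_sum (n%:R * h) h (n + n) G + h)%:E)%E.
Proof.
move=> h0 Gni G01 G1 G0.
set M := n%:R * h in G1 G0 *.
have M0 : 0 <= M by rewrite mulr_ge0// ltW.
have mG : measurable_fun setT G by apply: nonincreasing_measurable.
have mG' : measurable_fun setT (fun t => 1 - G t).
  by apply: measurable_funB.
have GE (D : set R) : measurable_fun D (fun t => (G t)%:E).
  by apply/measurable_EFinP; apply: measurable_funS mG.
have GE' (D : set R) : measurable_fun D (fun t => (1 - G t)%:E).
  by apply/measurable_EFinP; apply: measurable_funS mG'.
have Gge0 t : 0 <= G t by have /andP[] := G01 t.
have Gle1 t : 0 <= 1 - G t by have /andP[_] := G01 t; rewrite subr_ge0.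
(* Outside the window from [- M] to [M] both integrands vanish. The negative half is rewritten
   through [1 - G], so that only integrals of nonnegative functions are split. *)
have posE : (\int[leb]_(t in `[0%R, +oo[) (G t)%:E =
    \int[leb]_(t in `[0%R, (0 + n%:R * h)%R[) (G t)%:E)%E.
  have -> : `[0%R, +oo[%classic = `[0%R, 0 + n%:R * h[ `|` `[M, +oo[ :> set R.
    rewrite add0r -/M; apply/seteqP; split => t /=; rewrite !in_itv/= !andbT.
      by move=> ->; have [tM|] := ltP t M; [left|right].
    by case=> [/andP[]//|]; exact: le_trans.
  rewrite ge0_integral_setU//=; [|exact: GE|by move=> t _; rewrite lee_fin|].
  - rewrite [X in (_ + X)%E]integral0_eq ?adde0// => t /=.
    by rewrite in_itv/= andbT => /G0 ->.
  - rewrite disj_set2E; apply/eqP/seteqP; split => t //=; rewrite !in_itv/= add0r -/M; lra.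
have negE : (\int[leb]_(t in `]-oo, 0%R[) (G t - 1)%:E =
    - \int[leb]_(t in `[(- M)%R, (- M + n%:R * h)%R[) (1 - G t)%:E)%E.
  rewrite -/M addNr.
  have -> : `]-oo, 0%R[%classic = `]-oo, (- M)%R[ `|` `[(- M)%R, 0%R[ :> set R.
    apply/seteqP; split => t /=; rewrite !in_itv/=.
      by move=> ->; have [tM|] := ltP t (- M); [left|right].
    by case=> [|/andP[]//]; lra.
  transitivity (\int[leb]_(t in `]-oo, (- M)%R[ `|` `[(- M)%R, 0%R[) (- (1 - G t)%:E))%E.
    by apply: eq_integral => t _; rewrite -EFinN opprB.
  rewrite integral_ge0N; last by move=> t _; rewrite lee_fin.
  rewrite ge0_integral_setU//=; [|exact: GE'|by move=> t _; rewrite lee_fin|].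
  - rewrite [X in (X + _)%E]integral0_eq ?add0e// => t /=.
    by rewrite in_itv/= => /G1 ->; rewrite subrr.
  - rewrite disj_set2E; apply/eqP/seteqP; split => t //=; rewrite !in_itv/=; lra.
rewrite posE negE.
have in_step a j t : a + j%:R * h <= t < a + j.+1%:R * h ->
    G (a + j.+1%:R * h) <= G t <= G (a + j%:R * h).
  by move=> /andP[at_ ta]; rewrite !Gni// ltW.
have /andP[p1 p2] := @integral_piecewise_bounds G 0 h
  (fun j => G (0 + j.+1%:R * h)) (fun j => G (0 + j%:R * h)) n h0 mG Gge0
  (fun _ => Gge0 _) (fun j t _ => @in_step 0 j t).
have in_step' j t : - M + j%:R * h <= t < - M + j.+1%:R * h ->
    1 - G (- M + j%:R * h) <= 1 - G t <= 1 - G (- M + j.+1%:R * h).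
  by move=> /in_step /andP[? ?]; rewrite !lerD2l !lerN2; apply/andP.
have /andP[n1 n2] := @integral_piecewise_bounds (fun t => 1 - G t) (- M) h
  (fun j => 1 - G (- M + j%:R * h)) (fun j => 1 - G (- M + j.+1%:R * h)) n h0 mG' Gle1
  (fun _ => Gle1 _) (fun j t _ => @in_step' j t).
(* Left and right endpoint sums differ only by the end values. Over the two halves the values at 0
   cancel, leaving [h * (G (- M) - G M)], which is at most [h]. *)
have tele (g : nat -> R) : \sum_(j < n) g j = \sum_(j < n) g j.+1 + g 0%N - g n.
  by elim: (n) => [|m IH]; rewrite ?big_ord0 ?big_ord_recr/= ?IH; lra.
(* The first [n] cells form the negative half: writing [G] as [1 - (1 - G)] there, the ones
   contribute [n%:R * h], which cancels [- M]. *)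
have SE : riemann_sum M h (n + n) G =
    h * \sum_(j < n) G (0 + j.+1%:R * h) - h * \sum_(j < n) (1 - G (- M + j.+1%:R * h)).
  rewrite /riemann_sum big_split_ord/= sumrB sumr_const card_ord.
  have -> : \sum_(i < n) G (- M + (n + i).+1%:R * h) = \sum_(i < n) G (0 + i.+1%:R * h).
    by apply: eq_bigr => j _; rewrite -addnS natrD mulrDl addrA addNr.
  by rewrite mulrBr mulrDr mulr_natr -[h *+ n]mulr_natl -/M; lra.
have := leeB p1 n2; have := leeB p2 n1.
rewrite -!EFinB -SE => I2 ->/=; apply: le_trans I2 _; rewrite lee_fin SE.
rewrite (tele (fun j => G (0 + j%:R * h))) (tele (fun j => 1 - G (- M + j%:R * h))).
rewrite -/M addNr !mul0r !addr0 add0r !mulrBr !mulrDr mulr1.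
have /andP[_ GM1] := G01 (- M); have GM0 := Gge0 M.
move: (\sum_(_ < _) _) (\sum_(_ < _) _) => u v.
have : h * (1 - G (- M) + G M) >= 0 by rewrite mulr_ge0 ?(ltW h0)//; lra.
lra.
Qed.
End choquet_riemann.

(** * Calculus of upper and lower probabilities *)

Section upper_probability.
Context {d : measure_display} {T : measurableType d} {R : realType}.
Variable Ps : set (set T -> R).
Hypothesis Ps0 : Ps !=set0.
Hypothesis faPs : forall P, Ps P -> fa_prob P.

Implicit Types (P : set T -> R) (A B : set T).

Lemma upper_ge P A : Ps P -> measurable A -> P A <= upper Ps A.
Proof.
move=> PsP mA; apply: ub_le_sup; last by exists P.
by exists 1 => _ [Q PsQ <-]; have /andP[] := fa_prob_itv (faPs PsQ) mA.
Qed.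

Lemma upper_le_ub A b : (forall P, Ps P -> P A <= b) -> upper Ps A <= b.
Proof.
move=> h; apply: ge_sup; last by move=> _ [Q PsQ <-]; exact: h.
by have [P PsP] := Ps0; exists (P A), P.
Qed.

Lemma lower_le P A : Ps P -> measurable A -> lower Ps A <= P A.
Proof.
move=> PsP mA; apply: ge_inf; last by exists P.
by exists 0 => _ [Q PsQ <-]; have /andP[] := fa_prob_itv (faPs PsQ) mA.
Qed.

Lemma lower_ge_lb A b : (forall P, Ps P -> b <= P A) -> b <= lower Ps A.
Proof.
move=> h; apply: lb_le_inf; last by move=> _ [Q PsQ <-]; exact: h.
by have [P PsP] := Ps0; exists (P A), P.
Qed.

Lemma upperC A : measurable A -> upper Ps (~` A) = 1 - lower Ps A.
Proof.
move=> mA; apply/eqP; rewrite eq_le; apply/andP; split.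
  by apply: upper_le_ub => P PsP; rewrite (fa_probC (faPs PsP))// lerD2l lerN2 lower_le.
rewrite lerBlDr -lerBlDl; apply: lower_ge_lb => P PsP.
have := upper_ge PsP (measurableC mA); rewrite (fa_probC (faPs PsP))//; lra.
Qed.

Lemma upper_subset A B : measurable A -> measurable B -> A `<=` B ->
  upper Ps A <= upper Ps B.
Proof.
move=> mA mB AB; apply: upper_le_ub => P PsP.
exact: le_trans (fa_prob_le (faPs PsP) mA mB AB) (upper_ge PsP mB).
Qed.

Lemma lower_subset A B : measurable A -> measurable B -> A `<=` B ->
  lower Ps A <= lower Ps B.
Proof.
move=> mA mB AB; apply: lower_ge_lb => P PsP.
exact: le_trans (lower_le PsP mA) (fa_prob_le (faPs PsP) mA mB AB).
Qed.

Lemma upper_itv A : measurable A -> 0 <= upper Ps A <= 1.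
Proof.
move=> mA; have [P PsP] := Ps0; have /andP[P0 _] := fa_prob_itv (faPs PsP) mA.
rewrite (le_trans P0 (upper_ge PsP mA))/=; apply: upper_le_ub => Q PsQ.
by have /andP[] := fa_prob_itv (faPs PsQ) mA.
Qed.

Lemma lower_itv A : measurable A -> 0 <= lower Ps A <= 1.
Proof.
by move=> mA; have := upper_itv (measurableC mA); rewrite upperC//; lra.
Qed.

Lemma upperT : upper Ps setT = 1.
Proof.
apply/eqP; rewrite eq_le; have /andP[_ ->] := upper_itv measurableT.
by have [P PsP] := Ps0; rewrite -(faPs PsP).1 upper_ge.
Qed.

Lemma upper0 : upper Ps set0 = 0.
Proof.
apply/eqP; rewrite eq_le; have /andP[-> _] := upper_itv measurable0.
by rewrite andbT; apply: upper_le_ub => P PsP; rewrite fa_prob0//; exact: faPs.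
Qed.

Lemma lowerT : lower Ps setT = 1.
Proof. by have := upperC measurableT; rewrite setCT upper0; lra. Qed.

Lemma lower0 : lower Ps set0 = 0.
Proof. by have := upperC measurable0; rewrite setC0 upperT; lra. Qed.

Lemma upper_null_subset A B : measurable A -> measurable B -> A `<=` B ->
  upper Ps B = 0 -> upper Ps A = 0.
Proof.
move=> mA mB AB B0; apply/eqP; rewrite eq_le; have /andP[-> _] := upper_itv mA.
by rewrite andbT -B0 upper_subset.
Qed.

Lemma upperU A B : measurable A -> measurable B ->
  upper Ps (A `|` B) <= upper Ps A + upper Ps B.
Proof.
move=> mA mB; apply: upper_le_ub => P PsP.
have mBA := measurableD mB mA.
rewrite -(setDUK (@subsetUl _ A B)) setDUl setDv set0U.
rewrite (faPs PsP).2.2 ?setDIK// lerD ?upper_ge//.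
by apply: le_trans (upper_ge PsP mBA) (upper_subset mBA mB (@subDsetl _ _ _)).
Qed.

Hypothesis cU : cap_continuous (upper Ps).

(** Subadditivity makes the finite partial unions null, and continuity from below carries this to
    the limit. *)
Lemma upper_null_bigcup (A : nat -> set T) : (forall n, measurable (A n)) ->
  (forall n, upper Ps (A n) = 0) -> upper Ps (\bigcup_n A n) = 0.
Proof.
move=> mA A0; pose B n := \big[setU/set0]_(i < n.+1) A i.
have mB n : measurable (B n) by apply: bigsetU_measurable.
have B0 n : upper Ps (B n) = 0.
  rewrite /B; elim: n => [|n IH]; first by rewrite big_ord1 A0.
  rewrite big_ord_recr/=; apply/eqP; rewrite eq_le.
  have mU : measurable (\big[setU/set0]_(i < n.+1) A i `|` A n.+1).
    by apply: measurableU => //; exact: mB.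
  have /andP[-> _] := upper_itv mU; rewrite andbT.
  by rewrite (le_trans (upperU (mB n) (mA _)))// IH A0 addr0.
have := cU.1 B mB.
rewrite bigcup_bigsetU_bigcup => /(_ _)/wrap[].
  by move=> n; rewrite /B [X in _ `<=` X]big_ord_recr/=; exact: subsetUl.
under eq_fun do rewrite B0.
by move=> h; apply: (cvg_unique _ h (cvg_cst _)).
Qed.

End upper_probability.

(** * Stopping bounds and convergence of the averages off a null set *)

Section ergodic_process.
Context {d : measure_display} {T : measurableType d} {R : realType}.
Variables (Ps : set (set T -> R)) (Y : nat -> T -> R) (M : R).
Hypothesis Ps0 : Ps !=set0.
Hypothesis faPs : forall P, Ps P -> fa_prob P.
Hypothesis cU : cap_continuous (upper Ps).
Hypothesis mY : forall n, measurable_fun setT (Y n).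
Hypothesis bY : forall n w, `|Y n w| <= M.
Hypothesis ergY : ergodic (upper Ps) Y.

Lemma upper_tail_event B k : observable Y B ->
  upper Ps (tail_event Y k B) = upper Ps (tail_event Y 0 B).
Proof.
move=> oB; elim: k => // k <-.
exact: (ergY.1 _ (oB k).1).
Qed.

(** The error [g] counts visits to the event of a late first exceedance, so its expectation grows at
    rate at most [delta]. [C] is chosen before [L], so it disappears after division by [L]. *)
Lemma stopping_bound P s t delta : Ps P -> `|s| = 1 -> 0 < delta ->
  upper Ps (tail_event Y 0 [set x | forall m, ~ exceed s t m x]) = 0 ->
  exists C : R, forall L, exists g e, [/\ simple_exp P g e, e <= delta * L%:R &
    forall w, t * L%:R <= s * (\sum_(k < L) Y k w) + g w + C].
Proof.
move=> PsP s1 delta0 null.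
(* No exceedance up to time [N]. These events decrease to the null event of no exceedance at all. *)
pose A N := [set x | forall m, (m <= N)%N -> ~ exceed s t m x].
have oA N : observable Y (A N) by exact: observable_bounded_time.
have := cU.2 (fun N => tail_event Y 0 (A N)) (fun N => (oA N 0%N).2).
move=> /(_ _)/wrap[].
  by move=> N w h m mN; apply: h; exact: leqW.
have -> : \bigcap_N tail_event Y 0 (A N) =
    tail_event Y 0 [set x | forall m, ~ exceed s t m x].
  apply/seteqP; split => w h m; first exact: (h m I m (leqnn _)).
  by move=> _ p _; exact: h.
rewrite null => cvgA.
pose K := M + `|t|.
(* [0 <= K] is read off at a point [w], since [M] is only known to bound some [Y n w]; on an empty
   space the pathwise bound is vacuous. *)
have [w0|emp] := pselect (exists w : T, True); last first.
  exists 0 => L; exists (fun=> 0), 0; split.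
  - exact: simple_exp_cst (faPs PsP).
  - by rewrite mulr_ge0// ltW.
  - by move=> w; exfalso; apply: emp; exists w.
have K0 : 0 <= K.
  by rewrite addr_ge0//; have [w _] := w0; exact: le_trans (bY 0%N w).
(* Each visit costs [K]; the added 1 keeps the quotient meaningful when [K] is 0. *)
have eps0 : 0 < delta / (K + 1) by rewrite divr_gt0// ltr_wpDl.
have /cvgrPdist_lt /(_ _ eps0)[N _ /(_ N (leqnn _))] := cvgA.
rewrite sub0r normrN => hN.
have KV : K * upper Ps (tail_event Y 0 (A N)) <= delta.
  have := le_lt_trans (ler_norm _) hN; rewrite ltr_pdivlMr ?ltr_wpDl//.
  have /andP[] := upper_itv Ps0 faPs (oA N 0%N).2; nra.
exists (K * N.+1%:R) => L.
exists (fun w => K * \sum_(k < L) \1_(tail_event Y k (A N)) w).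
exists (K * \sum_(k < L) P (tail_event Y k (A N))); split.
- apply: simple_expZ; apply: (@simple_exp_sum _ _ _ P L (fun k => \1_(tail_event Y k (A N)))
    (fun k => P (tail_event Y k (A N)))) => k.
  by apply: simple_exp_indic; exact: (oA N k).2.
- have : \sum_(k < L) P (tail_event Y k (A N)) <=
      \sum_(k < L) upper Ps (tail_event Y 0 (A N)).
    apply: ler_sum => k _; rewrite -(upper_tail_event k (oA N)).
    by apply: upper_ge => //; exact: (oA N k).2.
  rewrite sumr_const card_ord -[_ *+ L]mulr_natr => /(ler_wpM2l K0) h.
  by apply: le_trans h _; rewrite mulrA; apply: (ler_wpM2r (ler0n R L)).
- move=> w.
  have := @stopping_sum_ge R K N L (fun i => s * Y i w - t)
    (fun k => w \in tail_event Y k (A N)).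
  move=> /(_ _)/wrap[].
    move=> i; rewrite (le_trans (ler_normB _ _))// normrM s1 mul1r.
    by rewrite /K lerD2r.
  move=> /(_ _)/wrap[].
    move=> k; rewrite notin_setE => h.
    have [n [nN hn]] : exists n, (n <= N)%N /\ exceed s t n (fun i => Y (k + i)%N w).
      apply: contrapT => nh; apply: h => n nN hn; apply: nh; by exists n.
    exists n => //; move: hn; rewrite /exceed /mkset => hn.
    by rewrite sumrB sumr_const card_ord -mulr_sumr -(mulr_natr t) subr_ge0 ltW.
  rewrite sumrB sumr_const card_ord -mulr_sumr -(mulr_natr t).
  have -> : \sum_(k < L) \1_(tail_event Y k (A N)) w =
      \sum_(k < L) (w \in tail_event Y k (A N))%:R :> R.
    by apply: eq_bigr => k _; rewrite indicE.
  lra.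
Qed.

Lemma linear_bounded_le0 (r C : R) : (forall L : nat, r * L%:R <= C) -> r <= 0.
Proof.
move=> h; rewrite leNgt; apply/negP => r0.
have [n0 /(_ n0 (leqnn _))] := @linear_dominates R r 0 (C + 1) r0.
have := h n0; lra.
Qed.

Lemma null_dichotomy B : observable Y B -> Defs.shift @^-1` B = B ->
  upper Ps (tail_event Y 0 B) = 0 \/ upper Ps (tail_event Y 0 (~` B)) = 0.
Proof. by move=> oB sB; have [] := ergY.2 B (oB 0%N).1 sB. Qed.

Lemma null_never_exceed s t :
  upper Ps (tail_event Y 0 (~` limsup_gt s t)) = 0 ->
  upper Ps (tail_event Y 0 [set x | forall m, ~ exceed s t m x]) = 0.
Proof.
have oA : observable Y [set x | forall m, ~ exceed s t m x].
  exact: observable_never_exceed.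
apply: upper_null_subset => //.
- exact: (oA 0%N).2.
- by have /observableC/(_ 0%N)[] := observable_limsup_gt mY s t.
- move=> w h [k _ /(_ 0%N I)[m _ hm]]; apply: (h m).
  by apply: exceed_subset hm; rewrite lerDl.
Qed.

Lemma limsup_gt_opp_null t u : 0 < t + u ->
  upper Ps (tail_event Y 0 (~` limsup_gt 1 t)) = 0 ->
  upper Ps (tail_event Y 0 (limsup_gt (-1) u)) = 0.
Proof.
move=> tu t0.
have [//|u0] := null_dichotomy (observable_limsup_gt mY (-1) u) (shift_limsup_gt (-1) u).
have [P PsP] := Ps0; exfalso.
(* Adding the bounds for [s = 1] and [s = -1] cancels the sums of [Y] and leaves slope [t + u]; the
   two errors consume half of it, which still contradicts boundedness in [L]. *)
have d0 : 0 < (t + u) / 4 by lra.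
have [C1 h1] := stopping_bound PsP (normr1 R) d0 (null_never_exceed t0).
have [C2 h2] := stopping_bound PsP (normrN1 R) d0 (null_never_exceed u0).
suff : (t + u) / 2 <= 0 by lra.
apply: (@linear_bounded_le0 _ (C1 + C2)) => L.
have [g1 [e1 [ge1 e1L hg1]]] := h1 L; have [g2 [e2 [ge2 e2L hg2]]] := h2 L.
have := @simple_exp_ge _ _ _ P _ _ ((t + u) * L%:R - C1 - C2) (faPs PsP)
  (simple_expD ge1 ge2).
move=> /(_ _)/wrap[].
  by move=> w; have := hg1 w; have := hg2 w; rewrite mul1r mulN1r; lra.
lra.
Qed.

Lemma ergodic_mean_cvg : exists c : R,
  upper Ps (tail_event Y 0 (~` mean_cvg c)) = 0.
Proof.
have sumM m w : `|\sum_(i < m.+1) Y (0 + i)%N w| <= M * m.+1%:R.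
  rewrite (le_trans (ler_norm_sum _ _ _))// mulr_natr -[X in _ *+ X]card_ord.
  by rewrite -sumr_const; apply: ler_sum.
(* Levels that the limsup exceeds off a null set; their supremum is the limit. *)
pose E := [set t | upper Ps (tail_event Y 0 (~` limsup_gt 1 t)) = 0].
(* With [k = 0] the slack is 1, so the averages must exceed [- M - 1], which the bound [M]
   guarantees. *)
have E0 : E (- M - 2).
  rewrite /E /mkset (_ : tail_event _ _ _ = set0) ?(upper0 Ps0 faPs)//.
  apply/seteqP; split => // w; apply; exists 0%N => // n _; exists n => //=.
  have := sumM n w; rewrite /exceed /mkset mul1r invr1 ler_norml => /andP[+ _].
  have : (0 : R) < n.+1%:R by rewrite ltr0n.
  nra.
have EM : ubound E M.
  move=> t Et; rewrite leNgt; apply/negP => Mt; move: Et.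
  rewrite /E /mkset (_ : tail_event _ _ _ = setT) ?(upperT Ps0 faPs).
    by move/eqP; rewrite oner_eq0.
  apply/seteqP; split => // w _ [k _ /(_ 0%N I)[m _]].
  have := sumM m w; rewrite /exceed /mkset mul1r ler_norml => /andP[_ +].
  have : M * m.+1%:R < (t + k.+1%:R^-1) * m.+1%:R.
    by rewrite ltr_pM2r ?ltr0n// ltr_wpDr.
  by move=> /lt_trans h + /h; rewrite leNgt => /negP.
have supE : has_sup E by split; [exists (- M - 2)|exists M].
have lt_sup t : t < sup E -> E t.
  move=> /(sup_gt supE.1)[t' Et' tt']; apply: upper_null_subset Et' => //.
  - by have /observableC/(_ 0%N)[] := observable_limsup_gt mY 1 t.
  - by have /observableC/(_ 0%N)[] := observable_limsup_gt mY 1 t'.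
  - by move=> w h1 h2; apply: h1; apply: limsup_gt_subset h2; exact: ltW.
exists (sup E); rewrite not_mean_cvgE.
pose A j := tail_event Y 0 (limsup_gt 1 (sup E + j.+1%:R^-1)).
pose B j := tail_event Y 0 (limsup_gt (-1) (- sup E + j.+1%:R^-1)).
have mA j : measurable (A j) by exact: (observable_limsup_gt mY _ _ 0%N).2.
have mB j : measurable (B j) by exact: (observable_limsup_gt mY _ _ 0%N).2.
have := @upper_null_bigcup _ _ _ Ps Ps0 faPs cU (fun j => A j `|` B j)
  (fun j => measurableU _ _ (mA j) (mB j)).
apply => j; apply/eqP; rewrite eq_le.
have /andP[-> _] := upper_itv Ps0 faPs (measurableU _ _ (mA j) (mB j)).
rewrite andbT (le_trans (upperU Ps0 faPs (mA j) (mB j)))//.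
have j0 : (0 : R) < j.+1%:R^-1 by rewrite invr_gt0.
have -> : upper Ps (A j) = 0.
  (* A level above [sup E] is not in [E], so the dichotomy leaves only the null alternative. *)
  have [//|nul] := null_dichotomy (observable_limsup_gt mY 1 _) (shift_limsup_gt 1 (sup E + j.+1%:R^-1)).
  by have := sup_upper_bound supE nul; rewrite leNgt ltrDl j0.
(* Going below [sup E] by half of 1/(j+1) gives a level in [E] whose sum with [- sup E + j.+1%:R^-1]
   is still positive. *)
rewrite add0r (@limsup_gt_opp_null (sup E - j.+1%:R^-1 / 2))//.
  by move: (_^-1) j0 => q q0; lra.
by apply: lt_sup; move: (_^-1) j0 => q q0; lra.
Qed.

(** * Riemann-sum bounds on the limit *)

Section almost_sure_limit.
Variable c : R.
Hypothesis Yc : upper Ps (tail_event Y 0 (~` mean_cvg c)) = 0.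

(** Off a null set the averages of [s Y] exceed any level below [s * c]. The stopping bound at
    [s * c - delta / 2], with error rate [delta / 2], is integrated against [P] after replacing each
    [s Y k] by the simple function [F k]; then [L] grows. *)
Lemma limit_le_exp P s (F : nat -> T -> R) (a : nat -> R) S : Ps P ->
  `|s| = 1 -> (forall k, simple_exp P (F k) (a k)) ->
  (forall k w, s * Y k w <= F k w) -> (forall k, a k <= S) -> s * c <= S.
Proof.
move=> PsP s1 Fa YF aS; apply/ler_addgt0Pr => delta delta0.
have null : upper Ps (tail_event Y 0
    [set x | forall m, ~ exceed s (s * c - delta / 2) m x]) = 0.
  apply: upper_null_subset Yc => //.
  - exact: (observable_never_exceed mY _ _ 0%N).2.
  - exact: (observable_not_mean_cvg mY _ 0%N).2.
  - by move=> w h /mean_cvg_le /(_ h); lra.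
have [C h] := stopping_bound PsP s1 (divr_gt0 delta0 (ltr0Sn R 1)) null.
suff : s * c - delta - S <= 0 by lra.
apply: (@linear_bounded_le0 _ C) => L.
have [g [e [ge eL hg]]] := h L.
have := @simple_exp_ge _ _ _ P _ _ ((s * c - delta / 2) * L%:R - C) (faPs PsP)
  (simple_expD (simple_exp_sum L Fa) ge).
move=> /(_ _)/wrap[].
  move=> w; have := hg w; rewrite mulr_sumr.
  have : \sum_(i < L) s * Y i w <= \sum_(i < L) F i w by apply: ler_sum.
  lra.
have : \sum_(i < L) a i <= \sum_(i < L) S by apply: ler_sum.
rewrite sumr_const card_ord -[_ *+ L]mulr_natr; lra.
Qed.


Lemma tail_event_levelE k b : tail_event Y k (level b) = [set w | b <= Y k w].
Proof. by rewrite /tail_event /level /mkset addn0. Qed.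

Lemma measurable_level k b : measurable [set w | b <= Y k w].
Proof. by rewrite -tail_event_levelE; exact: (observable_level b mY k).2. Qed.

Lemma upper_level P k b : Ps P ->
  P [set w | b <= Y k w] <= upper Ps [set w | b <= Y 0 w].
Proof.
move=> PsP; rewrite -(tail_event_levelE 0) -(upper_tail_event k (observable_level b mY)).
by rewrite tail_event_levelE upper_ge//; exact: measurable_level.
Qed.

(** Shift invariance is stated for the upper probability, so the bound passes through the complement
    and the conjugacy [upperC]. *)
Lemma lower_level P k b : Ps P ->
  lower Ps [set w | b <= Y 0 w] <= P [set w | b <= Y k w].
Proof.
move=> PsP; have faP := faPs PsP.
have := upper_ge faPs PsP (measurableC (measurable_level k b)).
rewrite -tail_event_levelE.
have -> : ~` tail_event Y k (level b) = tail_event Y k (~` level b) by [].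
rewrite (upper_tail_event k (observableC (observable_level b mY))).
have -> : tail_event Y k (~` level b) = ~` [set w | b <= Y k w].
  by rewrite -tail_event_levelE.
have -> : tail_event Y 0 (~` level b) = ~` [set w | b <= Y 0 w].
  by rewrite -tail_event_levelE.
rewrite fa_probC ?(upperC Ps0 faPs) ?tail_event_levelE//; first lra.
all: exact: measurable_level.
Qed.

Lemma indic_level k b w : \1_[set w | b <= Y k w] w = (b <= Y k w)%R%:R :> R.
Proof.
by rewrite indicE (_ : (w \in _) = (b <= Y k w))//; apply/idP/idP; rewrite inE.
Qed.

Lemma simple_exp_levels (P : set T -> R) k h J : simple_exp P
  (fun w => \sum_(j < J) \1_[set w | - M + j.+1%:R * h <= Y k w] w)
  (\sum_(j < J) P [set w | - M + j.+1%:R * h <= Y k w]).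
Proof.
apply: (@simple_exp_sum _ _ _ P J (fun j => \1_[set w | - M + j.+1%:R * h <= Y k w])
  (fun j => P [set w | - M + j.+1%:R * h <= Y k w])) => j.
by apply: simple_exp_indic; exact: measurable_level.
Qed.

Lemma limit_le_riemann_upper h J : 0 < h -> 2 * M <= J%:R * h ->
  c <= riemann_sum M h J (fun b => upper Ps [set w | b <= Y 0 w]) + h.
Proof.
move=> h0 MJ; have [P PsP] := Ps0; rewrite -(mul1r c).
apply: (limit_le_exp PsP (normr1 R) (fun k => simple_expD (simple_expD
  (simple_exp_cst (- M) (faPs PsP)) (simple_expZ h (simple_exp_levels P k h J)))
  (simple_exp_cst h (faPs PsP)))) => [k w|k].
  have /andP[_] := staircase_approx h0 (bY k w) MJ; rewrite /riemann_sum mul1r.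
  by under [X in _ <= _ + _ * X + _ -> _]eq_bigr do rewrite -indic_level.
rewrite /riemann_sum lerD2r lerD2l ler_wpM2l ?(ltW h0)//.
by apply: ler_sum => j _; exact: upper_level.
Qed.

Lemma riemann_lower_le_limit h J : 0 < h -> 2 * M <= J%:R * h ->
  riemann_sum M h J (fun b => lower Ps [set w | b <= Y 0 w]) <= c.
Proof.
move=> h0 MJ; have [P PsP] := Ps0; rewrite -lerN2 -mulN1r.
apply: (limit_le_exp PsP (normrN1 R) (fun k => simple_expZ (- 1) (simple_expD
  (simple_exp_cst (- M) (faPs PsP)) (simple_expZ h (simple_exp_levels P k h J)))))
  => [k w|k].
  rewrite !mulN1r lerN2.
  have /andP[+ _] := staircase_approx h0 (bY k w) MJ; rewrite /riemann_sum.
  by under [X in _ + _ * X <= _ -> _]eq_bigr do rewrite -indic_level.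
rewrite mulN1r lerN2 /riemann_sum lerD2l ler_wpM2l ?(ltW h0)//.
by apply: ler_sum => j _; exact: lower_level.
Qed.

End almost_sure_limit.

End ergodic_process.

(** * Choquet integrals of bounded functions and conclusion *)

Lemma choquet_riemann (d : measure_display) (T : measurableType d) (R : realType)
    (mu : set T -> R) (xi : T -> R) (M0 M h : R) (n : nat) :
  (forall A, measurable A -> 0 <= mu A <= 1) ->
  (forall A B, measurable A -> measurable B -> A `<=` B -> mu A <= mu B) ->
  mu setT = 1 -> mu set0 = 0 -> (forall b, measurable [set w | b <= xi w]) ->
  (forall w, `|xi w| <= M0) -> M0 < M -> 0 < h -> n%:R * h = M ->
  ((riemann_sum M h (n + n) (fun b => mu [set w | b <= xi w]))%:E <= choquet mu xi
    <= (riemann_sum M h (n + n) (fun b => mu [set w | b <= xi w]) + h)%:E)%E.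
Proof.
move=> mu01 mu_le muT mu0 mxi xiM M0M h0 nh; rewrite -nh.
apply: choquet_integral_riemann => //.
- by move=> s t st; apply: mu_le => // w /=; exact: le_trans.
- by move=> t; exact: mu01.
- move=> t; rewrite nh => tM; rewrite (_ : [set w | _] = setT)//.
  apply/seteqP; split => // w _ /=.
  by have := xiM w; rewrite ler_norml => /andP[]; lra.
- move=> t; rewrite nh => tM; rewrite (_ : [set w | _] = set0)//.
  apply/seteqP; split => // w /=.
  by have := xiM w; rewrite ler_norml => /andP[]; lra.
Qed.

Theorem theorem8 (d : measure_display) (T : measurableType d) (R : realType)
  (Ps : set (set T -> R)) (Y : nat -> T -> R) :
  Ps !=set0 ->
  (forall P, Ps P -> fa_prob P) ->
  cap_continuous (upper Ps) -> cap_continuous (lower Ps) ->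
  (forall n, measurable_fun setT (Y n)) ->
  (exists M : R, forall n w, `|Y n w| <= M) ->
  stationary (upper Ps) Y ->
  ergodic (upper Ps) Y ->
  exists c : R,
    lower Ps [set w | avg Y w n @[n --> \oo] --> c] = 1 /\
    (concave_cap (upper Ps) ->
       (choquet (lower Ps) (Y 0%N) <= c%:E <= choquet (upper Ps) (Y 0%N))%E).
Proof.
move=> Ps0 faPs cU _ mY [M0 bM0] _ ergY.
(* Strictly above the bound, so that the level event at [M] is empty and the tail function vanishes
   from [M] on; positive, so that the mesh [M / n.+1%:R] is. *)
pose M := `|M0| + 1.
have M0M : `|M0| < M by rewrite ltrDl.
have bM0' n w : `|Y n w| <= `|M0| by exact: le_trans (bM0 n w) (ler_norm _).
have bY n w : `|Y n w| <= M by exact: le_trans (bM0' n w) (ltW M0M).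
have M_gt0 : 0 < M by rewrite ltr_wpDl.
have [c Yc] := ergodic_mean_cvg Ps0 faPs cU mY bY ergY.
have mC : measurable [set w | avg Y w n @[n --> \oo] --> c].
  have := (observableC (observable_not_mean_cvg mY c) 0%N).2.
  by rewrite setCK.
exists c; split.
  have := upperC Ps0 faPs mC.
  have -> : ~` [set w | avg Y w n @[n --> \oo] --> c] = tail_event Y 0 (~` mean_cvg c).
    by [].
  by rewrite Yc; lra.
move=> _.
have msh b : measurable [set w | b <= Y 0 w] by exact: measurable_level.
have hn0 n : 0 < M / n.+1%:R by rewrite divr_gt0.
have hnE n : n.+1%:R * (M / n.+1%:R) = M by rewrite mulrC divfK.
have hJ n : 2 * M <= (n.+1 + n.+1)%:R * (M / n.+1%:R).
  by rewrite (natrD _ n.+1 n.+1) [leRHS]mulrDl hnE; lra.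
have small e : 0 < e -> exists n, M / n.+1%:R <= e.
  move=> e0; exists (Num.trunc (M / e)).
  by rewrite ler_pdivrMr// mulrC -ler_pdivrMr// ltW// truncnS_gt.
(* Sum and Choquet integral differ by at most the mesh; a mesh below [e] gives both inequalities up
   to [e]. *)
apply/andP; split; apply/lee_addgt0Pr => e e0; have [n hne] := small e e0.
- have /andP[_ h2] := choquet_riemann (lower_itv Ps0 faPs) (lower_subset Ps0 faPs)
    (lowerT Ps0 faPs) (lower0 Ps0 faPs) msh (bM0' 0%N) M0M (hn0 n) (hnE n).
  apply: le_trans h2 _; rewrite -EFinD lee_fin lerD//.
  exact: (riemann_lower_le_limit Ps0 faPs cU mY bY ergY Yc).
- have /andP[h1 _] := choquet_riemann (upper_itv Ps0 faPs) (upper_subset Ps0 faPs)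
    (upperT Ps0 faPs) (upper0 Ps0 faPs) msh (bM0' 0%N) M0M (hn0 n) (hnE n).
  have h := limit_le_riemann_upper Ps0 faPs cU mY bY ergY Yc (hn0 n) (hJ n).
  apply: le_trans (leeD h1 (lexx _)); rewrite -EFinD lee_fin.
  by apply: le_trans h _; rewrite lerD2l.
Qed.
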